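(* Let $r>0$ be constant, and consider the tubular hypersurfaces $\mathfrak{T}^{\{j;\lambda\}}(s,t,w)=\beta(s)+r\,U^{\{j;\lambda\}}(s,t,w)$ in $E_1^4$ for $(j;\lambda)\in\{(1;1),(2;1),(2;-1),(3;1),(3;-1),(4;1),(4;-1)\}$, where $$\begin{aligned} U^{\{1;1\}}&=\cos t\cos w\,F_2+\sin t\cos w\,F_3+\sin w\,F_4,\\ U^{\{2;1\}}&=\cosh t\sinh w\,F_2+\cosh w\,F_3+\sinh t\sinh w\,F_4,\\ U^{\{2;-1\}}&=\cosh t\cosh w\,F_2+\sinh w\,F_3+\sinh t\cosh w\,F_4,\\ U^{\{3;1\}}&=\sinh t\sinh w\,F_2+\cosh t\sinh w\,F_3+\cosh w\,F_4,\\ U^{\{3;-1\}}&=\sinh t\cosh w\,F_2+\cosh t\cosh w\,F_3+\sinh w\,F_4,\\ U^{\{4;1\}}&=\cosh w\,F_2+\sinh t\sinh w\,F_3+\cosh t\sinh w\,F_4,\\ U^{\{4;-1\}}&=\sinh w\,F_2+\sinh t\cosh w\,F_3+\cosh t\cosh w\,F_4. \end{aligned}$$ Each of these hypersurfaces is $(H,K)_{tw}$-Weingarten, $(H,K)_{ts}$-Weingarten and $(H,K)_{sw}$-Weingarten; that is, its mean curvature $H$ and Gaussian curvature $K$ satisfy $$H_tK_w-H_wK_t=0,\qquad H_sK_t-H_tK_s=0,\qquad H_sK_w-H_wK_s=0.$$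
   Context: $E_1^4$ is $\mathbb{R}^4$ with the inner product $g(x,y)=\langle x,y\rangle=-x_1y_1+x_2y_2+x_3y_3+x_4y_4$. For given $j$, $\beta:I\to E_1^4$ ($I$ an open interval) is a smooth unit-speed curve with smooth Frenet frame $F_1=\beta',F_2,F_3,F_4$, pairwise orthogonal, $g(F_i,F_i)=\varepsilon_i$, where $\varepsilon_j=-1$ and $\varepsilon_i=1$ for $i\neq j$. The Frenet equations are $$F_1'=k_1F_2,\quad F_2'=\varepsilon_3\varepsilon_4k_1F_1+k_2F_3,\quad F_3'=\varepsilon_1\varepsilon_4k_2F_2+k_3F_4,\quad F_4'=\varepsilon_1\varepsilon_2k_3F_3,$$ with smooth functions $k_1,k_2,k_3$ on $I$. For a parametrized hypersurface $\Gamma(u_1,u_2,u_3)$ with smooth unit normal field $N$: $g_{ik}=\langle\Gamma_{u_i},\Gamma_{u_k}\rangle$, $h_{ik}=\langle\Gamma_{u_iu_k},N\rangle$, $S=[g_{ik}]^{-1}[h_{ik}]$, $\varepsilon=\langle N,N\rangle$, $K=\varepsilon\det[h_{ik}]/\det[g_{ik}]$, and $H$ is defined by $3\varepsilon H=\operatorname{tr}(S)$. Here $(u_1,u_2,u_3)=(s,t,w)$; everything is considered at regular points (where $\det[g_{ik}]\neq0$). Subscripts $s,t,w$ on $H,K$ denote partial derivatives. *)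

(* Defs.v *)
From HB Require Import structures.
From mathcomp Require Import all_boot all_order all_algebra.
From mathcomp Require Import all_classical all_reals all_analysis.

Set Implicit Arguments.
Unset Strict Implicit.
Unset Printing Implicit Defensive.

Import Order.TTheory GRing.Theory Num.Theory.
Import numFieldNormedType.Exports.

Local Open Scope classical_set_scope.
Local Open Scope ring_scope.

Definition sinh (R : realType) (x : R) : R := (expR x - expR (- x)) / 2.
Definition cosh (R : realType) (x : R) : R := (expR x + expR (- x)) / 2.

Definition mink (R : realType) (x y : 'rV[R]_4) : R :=
  - (x 0 0 * y 0 0) + x 0 1 * y 0 1 + x 0 2 * y 0 2 + x 0 3 * y 0 3.

(* Only the values on the open set [I] matter; outside, [f] is arbitrary. *)
Definition smooth_on (R : realType) (V : normedModType R)
    (I : set R) (f : R -> V) : Prop :=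
  forall n x, I x -> derivable (derive1n n f) x 1.

Definition partial (R : realType) (n : nat) (V : normedModType R)
    (i : 'I_n) (f : 'rV[R]_n -> V) : 'rV[R]_n -> V :=
  fun u => 'D_(delta_mx 0 i) f u.

(* C^infinity on the open set [D]: every iterated partial derivative is
   Frechet differentiable, hence continuous, on [D]. *)
Definition smooth_field (R : realType) (n : nat) (V : normedModType R)
    (D : set 'rV[R]_n) (f : 'rV[R]_n -> V) : Prop :=
  forall (l : seq 'I_n) (u : 'rV[R]_n), D u ->
    differentiable (foldr (fun i h => partial i h) f l) u.

(* A parametrized hypersurface is a map from 'rV_3; the coordinates 0, 1, 2 of
   the parameter are u_1, u_2, u_3, i.e. s, t, w. *)
Definition first_form (R : realType) (G : 'rV[R]_3 -> 'rV[R]_4)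
    (u : 'rV[R]_3) : 'M[R]_3 :=
  \matrix_(i, k) mink (partial i G u) (partial k G u).

Definition second_form (R : realType) (G N : 'rV[R]_3 -> 'rV[R]_4)
    (u : 'rV[R]_3) : 'M[R]_3 :=
  \matrix_(i, k) mink (partial k (partial i G) u) (N u).

Definition shape_mx (R : realType) (G N : 'rV[R]_3 -> 'rV[R]_4)
    (u : 'rV[R]_3) : 'M[R]_3 :=
  invmx (first_form G u) *m second_form G N u.

Definition regular_point (R : realType) (G : 'rV[R]_3 -> 'rV[R]_4)
    (u : 'rV[R]_3) : Prop := \det (first_form G u) != 0.

Definition unit_normal_field (R : realType) (D : set 'rV[R]_3)
    (G N : 'rV[R]_3 -> 'rV[R]_4) : Prop :=
  [/\ smooth_field D N,
      forall u, D u -> `|mink (N u) (N u)| = 1 &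
      forall u (i : 'I_3), D u -> mink (partial i G u) (N u) = 0].

Definition gauss_curvature (R : realType) (G N : 'rV[R]_3 -> 'rV[R]_4)
    (u : 'rV[R]_3) : R :=
  mink (N u) (N u) * (\det (second_form G N u) / \det (first_form G u)).

Definition mean_curvature (R : realType) (G N : 'rV[R]_3 -> 'rV[R]_4)
    (u : 'rV[R]_3) : R :=
  \tr (shape_mx G N u) / (3 * mink (N u) (N u)).

(* [H] and [K] are functions on the parameter space, [a] and [b] the indices of
   the parameters with respect to which they are differentiated. *)
Definition weingarten_at (R : realType) (H K : 'rV[R]_3 -> R)
    (a b : 'I_3) (u : 'rV[R]_3) : Prop :=
  partial a H u * partial b K u - partial b H u * partial a K u = 0.

(* The frame vectors F_1, ..., F_4 are [F 0], ..., [F 3]: all frame indices,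
   including that of the timelike vector, are shifted by one. *)
Definition frame_sign (R : realType) (j i : 'I_4) : R :=
  if i == j then -1 else 1.

Record frenet_curve (R : realType) (j : 'I_4) (I : set R)
    (beta : R -> 'rV[R]_4) (F : 'I_4 -> R -> 'rV[R]_4)
    (k1 k2 k3 : R -> R) : Prop := FrenetCurve {
  frenet_smooth_curve : smooth_on I beta;
  frenet_smooth_frame : forall i, smooth_on I (F i);
  frenet_smooth_k1 : smooth_on I k1;
  frenet_smooth_k2 : smooth_on I k2;
  frenet_smooth_k3 : smooth_on I k3;
  frenet_tangent : forall s, I s -> derive1 beta s = F 0 s;
  frenet_norm : forall i s, I s -> mink (F i s) (F i s) = frame_sign R j i;
  frenet_orthogonal : forall i k s, I s -> i != k -> mink (F i s) (F k s) = 0;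
  frenet_eq1 : forall s, I s -> derive1 (F 0) s = k1 s *: F 1 s;
  frenet_eq2 : forall s, I s -> derive1 (F 1) s =
    (frame_sign R j 2 * frame_sign R j 3 * k1 s) *: F 0 s + k2 s *: F 2 s;
  frenet_eq3 : forall s, I s -> derive1 (F 2) s =
    (frame_sign R j 0 * frame_sign R j 3 * k2 s) *: F 1 s + k3 s *: F 3 s;
  frenet_eq4 : forall s, I s -> derive1 (F 3) s =
    (frame_sign R j 0 * frame_sign R j 1 * k3 s) *: F 2 s
}.

(* [Tube_jp] is {j; 1} and [Tube_jm] is {j; -1}. *)
Variant tube_kind : Type :=
  | Tube_1p | Tube_2p | Tube_2m | Tube_3p | Tube_3m | Tube_4p | Tube_4m.

Definition timelike_index (c : tube_kind) : 'I_4 :=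
  match c with
  | Tube_1p => 0
  | Tube_2p | Tube_2m => 1
  | Tube_3p | Tube_3m => 2
  | Tube_4p | Tube_4m => 3
  end.

(* Coordinates of U with respect to F_2, F_3, F_4. *)
Definition tube_coords (R : realType) (c : tube_kind) (t w : R) : R * R * R :=
  match c with
  | Tube_1p => (cos t * cos w, sin t * cos w, sin w)
  | Tube_2p => (cosh t * sinh w, cosh w, sinh t * sinh w)
  | Tube_2m => (cosh t * cosh w, sinh w, sinh t * cosh w)
  | Tube_3p => (sinh t * sinh w, cosh t * sinh w, cosh w)
  | Tube_3m => (sinh t * cosh w, cosh t * cosh w, sinh w)
  | Tube_4p => (cosh w, sinh t * sinh w, cosh t * sinh w)
  | Tube_4m => (sinh w, sinh t * cosh w, cosh t * cosh w)
  end.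

Definition tube_direction (R : realType) (c : tube_kind)
    (F : 'I_4 -> R -> 'rV[R]_4) (s t w : R) : 'rV[R]_4 :=
  let: (a, b, d) := tube_coords c t w in
  a *: F 1 s + b *: F 2 s + d *: F 3 s.

Definition tube (R : realType) (c : tube_kind) (beta : R -> 'rV[R]_4)
    (F : 'I_4 -> R -> 'rV[R]_4) (r : R) (u : 'rV[R]_3) : 'rV[R]_4 :=
  beta (u 0 0) + r *: tube_direction c F (u 0 0) (u 0 1) (u 0 2).

(* Main.v *)
Require Import Defs.
From HB Require Import structures.
From mathcomp Require Import all_boot all_order all_algebra.
From mathcomp Require Import all_classical all_reals all_analysis.
From mathcomp Require Import ring lra.

Import Order.TTheory GRing.Theory Num.Theory.
Import numFieldNormedType.Exports.

Local Open Scope classical_set_scope.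
Local Open Scope ring_scope.

(** Every regular tube is a linear Weingarten hypersurface: near each point
    its curvatures satisfy [K = a * H + b] with constants [a], [b], so the
    gradients of [H] and [K] are proportional and all the Jacobians vanish.

    Write the tube as [G = beta + r *: U].  In all seven cases the coordinates
    of [U] parametrize a quadric [<U, U> = lam] with [lam] equal to [1] or
    [-1] ([direction_field_norm]), and [U] is orthogonal to the tangent [F 0]
    of the curve.  Hence [U] is orthogonal to [G_s], [G_t], [G_w], and at a
    regular point the unit normal is [N = sg *: U] with a locally constant
    sign [sg] ([mink_normalE]).

    The fields [r *: U] and [G] have the same partial derivatives, except that
    [G_s = F 0 + r *: U_s], and [F 0] is orthogonal to [G_t] and [G_w].
    Differentiating [<G_i, U> = 0] therefore shows that the second fundamental
    form is [- sg / r] times the first one, modified in its [(s, s)] entry only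
    ([canal_second_form]).  So the shape matrix is [- sg / r] times a rank one
    perturbation of the identity: two principal curvatures are the constant
    [- sg / r], and the third one enters both the trace and the determinant to
    the first degree.  Eliminating it gives the affine relation
    [K = 3 / r ^+ 2 * H + 2 * lam * sg / r ^+ 3] ([canal_curvature_affine]). *)

(** * Shape matrices that are scalar up to one entry *)

(** The determinant is affine in each entry, the slope being the cofactor. *)
Lemma det_sub_delta (R : comNzRingType) (n : nat) (A : 'M[R]_n) (m : R)
    (i j : 'I_n) :
  \det (A - m *: delta_mx i j) = \det A - m * cofactor A i j.
Proof.
rewrite (expand_det_row _ i) (expand_det_row A i).
have cofE k : cofactor (A - m *: delta_mx i j) i k = cofactor A i k.
  congr (_ * \det _); apply/matrixP => x y.
  by rewrite !mxE eq_sym (negbTE (neq_lift i x)) mulr0 subr0.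
under eq_bigr do rewrite cofE !mxE eqxx mulrBl.
rewrite sumrB; congr (_ - _).
rewrite (bigD1 j)//= eqxx mulr1 big1 ?addr0// => k /negbTE ->.
by rewrite mulr0 mul0r.
Qed.

(** If [h] is [- a *: g] up to one diagonal entry, then [- a] is an eigenvalue
    of [invmx g *m h] of multiplicity at least [n], so that its determinant is
    [(- a) ^+ n] times the remaining eigenvalue, and its trace is [- a *+ n]
    plus that eigenvalue. *)
Lemma det_shape_affine_trace (K : fieldType) (n : nat) (g : 'M[K]_n.+1)
    (a m : K) (i : 'I_n.+1) :
  \det g != 0 ->
  let h := - a *: (g - m *: delta_mx i i) in
  \det h / \det g = (- a) ^+ n * (\tr (invmx g *m h) + n%:R * a).
Proof.
move=> g0 h.
have gU : g \in unitmx by rewrite unitmxE unitfE.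
have -> : \tr (invmx g *m h) = - a * (n.+1%:R - m * (cofactor g i i / \det g)).
  rewrite /h -scalemxAr mxtraceZ mulmxBr mulVmx// mxtraceD mxtrace1.
  rewrite -scalemxAr -scaleN1r !mxtraceZ mxtrace_mulC /invmx gU.
  rewrite -scalemxAr mxtraceZ.
  have -> : \tr (delta_mx i i *m \adj g) = cofactor g i i.
    rewrite /mxtrace (bigD1 i)//= mxE (bigD1 i)//= big1 => [|k /negbTE ki].
      rewrite !mxE !eqxx mul1r addr0 big1 ?addr0// => k /negbTE ki.
      by rewrite mxE big1// => l _; rewrite !mxE ki mul0r.
    by rewrite !mxE ki andbF mul0r.
  ring.
rewrite detZ det_sub_delta exprS -natr1.
by field.
Qed.

(** * The Minkowski product *)

Section mink.
Context {R : realType}.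
Implicit Types x y z : 'rV[R]_4.

Lemma minkC x y : mink x y = mink y x.
Proof. by rewrite /mink; ring. Qed.

Lemma minkDl x y z : mink (x + y) z = mink x z + mink y z.
Proof. by rewrite /mink !mxE; ring. Qed.

Lemma minkZl a x y : mink (a *: x) y = a * mink x y.
Proof. by rewrite /mink !mxE; ring. Qed.

Lemma minkDr x y z : mink z (x + y) = mink z x + mink z y.
Proof. by rewrite ![mink z _]minkC minkDl. Qed.

Lemma minkZr a x y : mink x (a *: y) = a * mink x y.
Proof. by rewrite ![mink x _]minkC minkZl. Qed.

Lemma mink_suml (I : finType) (f : I -> 'rV[R]_4) y :
  mink (\sum_i f i) y = \sum_i mink (f i) y.
Proof.
have mink0 : mink 0 y = 0 by rewrite -(scale0r 0) minkZl mul0r.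
exact: (big_morph (fun x => mink x y) (fun u v => minkDl u v y) mink0).
Qed.

Lemma mink_sumr (I : finType) (f : I -> 'rV[R]_4) x :
  mink x (\sum_i f i) = \sum_i mink x (f i).
Proof. by rewrite minkC mink_suml; apply: eq_bigr => i _; exact: minkC. Qed.

Let eta : 'rV[R]_4 := \row_i (if i == 0 then -1 else 1).

(** The Minkowski product as a matrix product: this turns statements on Gram
    matrices into statements on determinants. *)
Lemma mink_mulmx (m n : nat) (A : 'M[R]_(m, 4)) (B : 'M[R]_(n, 4)) i j :
  (A *m diag_mx eta *m B^T) i j = mink (row i A) (row j B).
Proof.
rewrite mul_mx_diag mxE !big_ord_recl big_ord0 /mink !mxE /=.
rewrite (_ : lift ord0 ord0 = 1); last exact: val_inj.
rewrite (_ : lift ord0 _ = 2); last exact: val_inj.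
rewrite (_ : lift ord0 _ = 3); last exact: val_inj.
by rewrite addr0 !addrA mulrN1 mulNr !mulr1.
Qed.

(** The Gram matrix of the three [g i] and [v] is block diagonal with nonzero
    determinant, so these four vectors form a basis.  The difference of the two
    sides is orthogonal to all of them, and the product is nondegenerate. *)
Lemma mink_normalE (g : 'I_3 -> 'rV[R]_4) (l : R) (v n : 'rV[R]_4) :
  \det (\matrix_(i, k) mink (g i) (g k)) != 0 -> l != 0 ->
  mink v v = l -> (forall i, mink (g i) v = 0) ->
  (forall i, mink (g i) n = 0) ->
  n = (mink n v / l) *: v.
Proof.
move=> g0 l0 vv gv gn.
pose G : 'M[R]_(3, 4) := \matrix_i g i.
pose P : 'M[R]_(3 + 1, 4) := col_mx G v.
have gramE : P *m diag_mx eta *m P^T =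
    block_mx (\matrix_(i, k) mink (g i) (g k)) 0 0 l%:M.
  rewrite /P mul_col_mx tr_col_mx mul_col_row; congr block_mx; apply/matrixP.
  - by move=> i k; rewrite mink_mulmx !rowK mxE.
  - by move=> i k; rewrite mink_mulmx rowK row_id gv mxE.
  - by move=> i k; rewrite mink_mulmx rowK row_id minkC gv mxE.
  - by move=> i k; rewrite !ord1 mink_mulmx !row_id vv mxE eqxx.
have : P *m diag_mx eta \in unitmx.
  have: \det (P *m diag_mx eta *m P^T) != 0.
    by rewrite gramE det_ublock det_scalar1 mulf_neq0.
  by rewrite det_mulmx mulf_eq0 negb_or unitmxE unitfE => /andP[].
move=> /mulKmx PK.
suff : (n + - (mink n v / l) *: v)^T = 0.
  by move=> /(congr1 trmx); rewrite trmxK trmx0 scaleNr => /subr0_eq.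
rewrite -[LHS]PK (_ : _ *m _^T = 0) ?mulmx0//.
rewrite /P !mul_col_mx -[RHS]col_mx0; congr col_mx; apply/matrixP => i k.
  by rewrite mink_mulmx rowK row_id minkDr minkZr gv gn mulr0 addr0 mxE.
by rewrite mink_mulmx !row_id minkDr minkZr vv minkC mulNr divfK// subrr mxE.
Qed.

Lemma is_derive_mink (V : normedModType R) (f g : V -> 'rV[R]_4) p v df dg :
  is_derive p v f df -> is_derive p v g dg ->
  is_derive p v (fun q => mink (f q) (g q)) (mink df (g p) + mink (f p) dg).
Proof.
move=> fd gd.
have cd (h : V -> 'rV[R]_4) dh : is_derive p v h dh ->
    forall i, is_derive p v (fun q => h q 0 i) (dh 0 i).
  move=> [hd <-] i; split; first exact: (derivable_mxP _ _ _).1.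
  by rewrite derive_mx// mxE.
have cf := cd _ _ fd; have cg := cd _ _ gd.
have cM i := is_deriveM (cf i) (cg i).
apply: (is_derive_eq (is_deriveD (is_deriveD (is_deriveD (is_deriveN (cM 0))
  (cM 1)) (cM 2)) (cM 3))).
by rewrite /mink /GRing.scale/=; ring.
Qed.

Lemma continuous_mink (T : topologicalType) (f g : T -> 'rV[R]_4) p :
  {for p, continuous f} -> {for p, continuous g} ->
  {for p, continuous (fun q => mink (f q) (g q))}.
Proof.
move=> fp gp.
have cf i : {for p, continuous (fun q => f q 0 i)}.
  apply: (@continuous_comp _ _ _ f (fun M : 'rV[R]_4 => M 0 i)) => //.
  exact: coord_continuous.
have cg i : {for p, continuous (fun q => g q 0 i)}.
  apply: (@continuous_comp _ _ _ g (fun M : 'rV[R]_4 => M 0 i)) => //.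
  exact: coord_continuous.
have cM i : {for p, continuous (fun q => f q 0 i * g q 0 i)}.
  exact: cvgM (cf i) (cg i).
exact: cvgD (cvgD (cvgD (cvgN (cM 0)) (cM 1)) (cM 2)) (cM 3).
Qed.

End mink.

(** * Derivatives *)

(** As [a != 0], the two difference quotients converge or diverge together, and
    a divergent one has derivative [0] by convention.  The equality thus holds
    at every point, and applies to the curvatures directly. *)
Lemma derive_affine (R : realType) (V : normedModType R) (f : V -> R) (a b : R)
    (p v : V) :
  a != 0 -> 'D_v (fun q => a * f q + b) p = a * 'D_v f p.
Proof.
move=> a0; set g := fun q => a * f q + b.
have quotE : (fun h => h^-1 *: ((g \o shift p) (h *: v) - g p)) =
    (fun h => a * (h^-1 *: ((f \o shift p) (h *: v) - f p))).
  by apply/funext => h; rewrite /g /GRing.scale/=; ring.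
have [fp|fp] := pselect (derivable f p v).
  by apply: cvg_lim => //; rewrite quotE; exact: cvgMr.
have gp : ~ derivable g p v.
  apply: contra_not fp; rewrite /derivable quotE => gp.
  have -> : (fun h => h^-1 *: ((f \o shift p) (h *: v) - f p)) =
      (fun h => a^-1 * (a * (h^-1 *: ((f \o shift p) (h *: v) - f p)))).
    by apply/funext => h; rewrite mulKf.
  exact: is_cvgMr.
by rewrite /derive (dvgP gp) (dvgP fp) mulr0.
Qed.

Lemma weingarten_of_affine (R : realType) (H K : 'rV[R]_3 -> R) (a b : R)
    (i j : 'I_3) (p : 'rV[R]_3) :
  a != 0 -> {near p, K =1 (fun q => a * H q + b)} ->
  weingarten_at H K i j p.
Proof.
move=> a0 KH; rewrite /weingarten_at /partial.
rewrite !(near_eq_derive _ KH) !(derive_affine _ _ _ _ _ _ _ a0); ring.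
Qed.

Lemma is_derive_along_coord (R : realType) (n : nat) (V : normedModType R)
    (f : 'rV[R]_n -> V) (g : R -> V) (i : 'I_n) (p : 'rV[R]_n) (dg : V) :
  (forall h, f (h *: delta_mx 0 i + p) = g (h + p 0 i)) ->
  is_derive (p 0 i) 1 g dg -> is_derive p (delta_mx 0 i) f dg.
Proof.
move=> fg [gp <-].
have quotE : (fun h => h^-1 *: ((f \o shift p) (h *: delta_mx 0 i) - f p)) =
    (fun h => h^-1 *: ((g \o shift (p 0 i)) (h *: 1) - g (p 0 i))).
  apply/funext => h; rewrite /= fg [h *: 1]mulr1.
  by have := fg 0; rewrite scale0r !add0r => ->.
by split; rewrite /derive /derivable quotE.
Qed.

Lemma is_derive_scale_vector (R : realType) (V W : normedModType R) (f : V -> R)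
    (y : W) (p v : V) (df : R) :
  is_derive p v f df -> is_derive p v (fun q => f q *: y) (df *: y).
Proof.
move=> [fp <-].
have quotE : (fun h => h^-1 *: (((fun q => f q *: y) \o shift p) (h *: v)
      - f p *: y)) =
    (fun h => (h^-1 *: ((f \o shift p) (h *: v) - f p)) *: y).
  by apply/funext => h; rewrite /= -scalerBl scalerA.
split; first by rewrite /derivable quotE; exact: is_cvgZr_tmp.
by apply: cvg_lim => //; rewrite quotE; exact: cvgZr_tmp.
Qed.

Section split_field.
Context {R : realType} {V : normedModType R}.
Implicit Types (P Q : R -> R) (X : R -> V) (u : 'rV[R]_3).

(** Fields of this form are stable under partial derivatives, since each
    variable occurs in its own factor; the tubes are sums of them. *)
Definition split_field P Q X (u : 'rV[R]_3) : V :=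
  (P (u 0 1) * Q (u 0 2)) *: X (u 0 0).

Definition dsplit_field (k : 'I_3) P Q X : 'rV[R]_3 -> V :=
  split_field (if k == 1 then derive1 P else P)
    (if k == 2 then derive1 Q else Q) (if k == 0 then derive1 X else X).

Lemma is_derive_split_field P Q X (k : 'I_3) u :
  derivable P (u 0 1) 1 -> derivable Q (u 0 2) 1 -> derivable X (u 0 0) 1 ->
  is_derive u (delta_mx 0 k) (split_field P Q X) (dsplit_field k P Q X u).
Proof.
move=> dP dQ dX; set c := P (u 0 1) * Q (u 0 2).
have [k0|k1|k2] : [\/ k = 0, k = 1 | k = 2].
  case: k => -[|[|[|//]]] ?; [apply: Or31|apply: Or32|apply: Or33];
  exact: val_inj.
- rewrite k0 /dsplit_field /split_field /= derive1E.
  apply: (@is_derive_along_coord _ _ _ _ (c \*: X)).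
    by move=> h; rewrite /= !mxE /= mulr1 !mulr0 !add0r.
  exact: is_deriveZ (derivableP dX).
- rewrite k1 /dsplit_field /split_field /= derive1E.
  apply: (@is_derive_along_coord _ _ _ _
    (fun x => P x *: (Q (u 0 2) *: X (u 0 0)))).
    by move=> h; rewrite /= !mxE /= mulr1 !mulr0 !add0r scalerA.
  by rewrite -scalerA; exact: is_derive_scale_vector (derivableP dP).
- rewrite k2 /dsplit_field /split_field /= derive1E mulrC.
  apply: (@is_derive_along_coord _ _ _ _
    (fun x => Q x *: (P (u 0 1) *: X (u 0 0)))).
    by move=> h; rewrite /= !mxE /= mulr1 !mulr0 !add0r scalerA mulrC.
  by rewrite -scalerA; exact: is_derive_scale_vector (derivableP dQ).
Qed.

Lemma continuous_split_field P Q X u :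
  derivable P (u 0 1) 1 -> derivable Q (u 0 2) 1 -> derivable X (u 0 0) 1 ->
  {for u, continuous (split_field P Q X)}.
Proof.
move=> dP dQ dX.
have cc (W : normedModType R) (Y : R -> W) i : derivable Y (u 0 i) 1 ->
    {for u, continuous (fun v : 'rV[R]_3 => Y (v 0 i))}.
  move=> /derivable1_diffP/differentiable_continuous cY.
  apply: (@continuous_comp _ _ _ (fun M : 'rV[R]_3 => M 0 i) Y) => //.
  exact: coord_continuous.
exact: cvgZ (cvgM (cc _ _ _ dP) (cc _ _ _ dQ)) (cc _ _ _ dX).
Qed.

End split_field.

(** * Hypersurfaces at constant distance from a curve *)

(** The part of the geometry of tubes that yields the curvature relation.  The
    map [G] moves like its would-be normal field [r *: U], except that the
    first variable adds a motion along a field [T] which is orthogonal to [U]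
    and to the other two tangent vectors. *)
Section canal.
Context {R : realType}.
Variables (D : set 'rV[R]_3) (G N U T : 'rV[R]_3 -> 'rV[R]_4) (r lam : R).
Hypotheses (openD : open D) (r_neq0 : r != 0) (lam_unit : `|lam| = 1).
Hypotheses (D_regular : forall u, D u -> regular_point G u)
  (normalN : unit_normal_field D G N).
Hypotheses
  (U_cont : forall u, D u -> {for u, continuous U})
  (U_derivable : forall u (k : 'I_3), D u -> derivable U u (delta_mx 0 k))
  (dG_derivable : forall u (i k : 'I_3), D u ->
    derivable (partial i G) u (delta_mx 0 k))
  (U_norm : forall u, D u -> mink (U u) (U u) = lam)
  (TU_orthogonal : forall u, D u -> mink (T u) (U u) = 0)
  (dG_eq : forall u k, D u ->
    partial k G u = (k == 0)%:R *: T u + r *: partial k U u)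
  (dGT_orthogonal : forall u (k : 'I_3), D u -> k != 0 ->
    mink (partial k G u) (T u) = 0).

Let near_D u : D u -> \near u, D u.
Proof. by move=> Du; exact: open_nbhs_nbhs. Qed.

Let lam_neq0 : lam != 0.
Proof. by rewrite -normr_gt0 lam_unit. Qed.

(** [U] is orthogonal to its own derivatives because [<U, U>] is constant. *)
Lemma canal_normal u k : D u -> mink (partial k G u) (U u) = 0.
Proof.
move=> Du; rewrite dG_eq// minkDl !minkZl TU_orthogonal// mulr0 add0r.
have Ud := derivableP (U_derivable _ k Du).
have [_ UU'] := is_derive_mink _ _ _ _ _ _ _ Ud Ud.
have UU0 : 'D_(delta_mx 0 k) (fun v => mink (U v) (U v)) u = 0.
  rewrite (@near_eq_derive _ _ _ _ (cst lam)) ?derive_cst//.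
  by apply: filterS (near_D _ Du) => v; exact: U_norm.
suff -> : mink (partial k U u) (U u) = 0 by rewrite mulr0.
move: UU'; rewrite UU0 [mink (U u) _]minkC /partial; lra.
Qed.

Let sg u := mink (N u) (U u) / lam.

Let N_eq u : D u -> N u = sg u *: U u.
Proof.
move=> Du; have [_ _ Northo] := normalN.
apply: mink_normalE (D_regular _ Du) lam_neq0 (U_norm _ Du) _ _ => i.
  exact: canal_normal.
exact: Northo.
Qed.

Let sg_unit u : D u -> `|sg u| = 1.
Proof.
move=> Du; have [_ /(_ u Du) + _] := normalN.
rewrite N_eq// minkZl minkZr U_norm// !normrM lam_unit mulr1 -expr2 => sg1.
by apply/eqP; rewrite -sqrp_eq1// sg1.
Qed.

(* A continuous function with values in {1, -1} is locally constant. *)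
Let sg_near u : D u -> \forall v \near u, D v /\ sg v = sg u.
Proof.
move=> Du; have [/(_ [::] u Du)/= Nd _ _] := normalN.
have sgc : {for u, continuous sg}.
  have := continuous_mink _ _ _ _ (differentiable_continuous Nd) (U_cont _ Du).
  by move=> /cvgM; apply; exact: cvg_cst.
near=> v; have Dv : D v by near: v; exact: near_D.
split=> //; have : `|sg u - sg v| < 1 by near: v; apply: cvgr_dist_lt.
have := sg_unit _ Du; have := sg_unit _ Dv.
move=> /eqP; rewrite eqr_norml ler01 andbT => /orP[]/eqP -> /eqP;
rewrite eqr_norml ler01 andbT => /orP[]/eqP -> //;
rewrite ltr_norml => /andP[? ?]; lra.
Unshelve. all: by end_near. Qed.

(** Differentiating [<G_i, U> = 0] along [k] gives [<G_ik, U> = - <G_i, U_k>],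
    and [r *: U_k] is [G_k] up to the contribution of [T], which is only seen
    when both indices are [0]. *)
Lemma canal_second_form u : D u ->
  second_form G N u = - (sg u / r) *:
    (first_form G u - mink (partial 0 G u) (T u) *: delta_mx 0 0).
Proof.
move=> Du; apply/matrixP => i k; rewrite !mxE N_eq// minkZr.
have GUk : mink (partial k (partial i G) u) (U u) =
    - mink (partial i G u) (partial k U u).
  have [_ GU'] := is_derive_mink _ _ _ _ _ _ _
    (derivableP (dG_derivable _ i k Du)) (derivableP (U_derivable _ k Du)).
  have GU0 : 'D_(delta_mx 0 k) (fun v => mink (partial i G v) (U v)) u = 0.
    rewrite (@near_eq_derive _ _ _ _ (cst 0)) ?derive_cst//.
    by apply: filterS (near_D _ Du) => v; exact: canal_normal.
  by move: GU'; rewrite GU0 /partial; lra.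
have gE : mink (partial i G u) (partial k G u) =
    (k == 0)%:R * mink (partial i G u) (T u) +
    r * mink (partial i G u) (partial k U u).
  by rewrite -!minkZr -minkDr -dG_eq.
have combine (A y g m d : R) : A = - y -> g = m * d + r * y ->
    sg u * A = - (sg u / r) * (g - m * d).
  by move=> -> ->; field.
apply: combine GUk _; rewrite {}gE; congr (_ + _).
have [k0|k0] := eqVneq k 0; last by rewrite andbF mul0r mulr0.
have [->|i0] := eqVneq i 0; first by rewrite mulrC.
by rewrite (dGT_orthogonal _ _ Du i0) !mulr0.
Qed.

(** The sign of the normal is taken at [u], not at [v], so that the
    coefficients on the right are constants near [u]. *)
Lemma canal_curvature_affine u : D u ->
  \forall v \near u, gauss_curvature G N v =
    3 / r ^+ 2 * mean_curvature G N v + 2 * lam * sg u / r ^+ 3.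
Proof.
move=> Du; apply: filterS (sg_near _ Du) => v [Dv sgE].
have s2 : sg v ^+ 2 = 1 by rewrite -real_normK ?num_real// sg_unit ?expr1n.
have l2 : lam ^+ 2 = 1 by rewrite -real_normK ?num_real// lam_unit expr1n.
have NN : mink (N v) (N v) = lam.
  by rewrite N_eq// minkZl minkZr U_norm// mulrA -expr2 s2 mul1r.
rewrite /gauss_curvature /mean_curvature /shape_mx NN.
have := det_shape_affine_trace _ _ (first_form G v) (sg v / r)
  (mink (partial 0 G v) (T v)) 0 (D_regular _ Dv).
rewrite /= -canal_second_form// => ->.
have lamV : lam^-1 = lam by apply: (mulfI lam_neq0); rewrite divff// -expr2 l2.
rewrite sqrrN expr_div_n s2 -sgE (invfM 3 lam) lamV.
by field.
Qed.

End canal.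

(** * The directions of the seven tubes *)

(** The one-variable factors of the coordinates of [U].  Naming them by a finite
    type makes the seven kinds of tubes a table, and reduces regularity to one
    statement about five functions. *)
Variant profile : Type := One | Cos | Sin | Cosh | Sinh.

Definition tube_profiles (c : tube_kind) (i : 'I_3) : profile * profile :=
  nth (One, One)
    match c with
    | Tube_1p => [:: (Cos, Cos); (Sin, Cos); (One, Sin)]
    | Tube_2p => [:: (Cosh, Sinh); (One, Cosh); (Sinh, Sinh)]
    | Tube_2m => [:: (Cosh, Cosh); (One, Sinh); (Sinh, Cosh)]
    | Tube_3p => [:: (Sinh, Sinh); (Cosh, Sinh); (One, Cosh)]
    | Tube_3m => [:: (Sinh, Cosh); (Cosh, Cosh); (One, Sinh)]
    | Tube_4p => [:: (One, Cosh); (Sinh, Sinh); (Cosh, Sinh)]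
    | Tube_4m => [:: (One, Sinh); (Sinh, Cosh); (Cosh, Cosh)]
    end i.

Section profiles.
Context {R : realType}.
Implicit Types x t w : R.

Lemma cosh2Bsinh2 x : cosh x ^+ 2 - sinh x ^+ 2 = 1.
Proof.
by rewrite /cosh /sinh expRN; field; exact: lt0r_neq0 (expR_gt0 x).
Qed.

Let is_derive_expRN x : is_derive x 1 (fun y => expR (- y)) (- expR (- x)).
Proof.
have -> : (fun y => expR (- y)) = @expR R \o -%R by [].
by apply: is_derive_eq; rewrite mulrN1.
Qed.

Definition twice_derivable (f : R -> R) :=
  forall x, derivable f x 1 /\ derivable (derive1 f) x 1.

Let twice_derivable_of (f g h : R -> R) :
  (forall x, is_derive x 1 f (g x)) -> (forall x, is_derive x 1 g (h x)) ->
  twice_derivable f.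
Proof.
move=> fg gh x; split; first exact: ex_derive.
have -> : derive1 f = g by apply/funext => y; rewrite derive1E derive_val.
exact: ex_derive.
Qed.

Lemma is_derive_sinh x : is_derive x 1 (@sinh R) (cosh x).
Proof.
have e1 := is_derive_expR x; have e2 := is_derive_expRN x.
have -> : @sinh R = 2^-1 \*: (@expR R - (fun y => expR (- y))).
  by apply/funext => y; rewrite /sinh mulrC.
by apply: is_derive_eq; rewrite opprK /cosh [RHS]mulrC.
Qed.

Lemma is_derive_cosh x : is_derive x 1 (@cosh R) (sinh x).
Proof.
have e1 := is_derive_expR x; have e2 := is_derive_expRN x.
have -> : @cosh R = 2^-1 \*: (@expR R + (fun y => expR (- y))).
  by apply/funext => y; rewrite /cosh mulrC.
by apply: is_derive_eq; rewrite /sinh [RHS]mulrC.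
Qed.

Definition profile_fun (f : profile) : R -> R :=
  match f with
  | One => cst 1 | Cos => cos | Sin => sin
  | Cosh => @cosh R | Sinh => @sinh R
  end.

Lemma twice_derivable_profile f : twice_derivable (profile_fun f).
Proof.
case: f => /=.
- exact: (twice_derivable_of _ (cst 0) (cst 0)).
- exact: (twice_derivable_of _ (fun x => - sin x) (fun x => - cos x)).
- exact: (twice_derivable_of _ cos (fun x => - sin x)).
- exact: twice_derivable_of is_derive_cosh is_derive_sinh.
- exact: twice_derivable_of is_derive_sinh is_derive_cosh.
Qed.

(** The value of [<U, U>] on each tube. *)
Definition tube_sign (c : tube_kind) : R :=
  match c with
  | Tube_1p | Tube_2p | Tube_3p | Tube_4p => 1
  | Tube_2m | Tube_3m | Tube_4m => -1
  end.

Definition tprofile c (i : 'I_3) := profile_fun (tube_profiles c i).1.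
Definition wprofile c (i : 'I_3) := profile_fun (tube_profiles c i).2.

Lemma tube_coordsE c t w :
  let y i := tprofile c i t * wprofile c i w in
  tube_coords c t w = (y 0, y 1, y 2).
Proof. by rewrite /tprofile /wprofile; case: c; rewrite /= ?mul1r. Qed.

(** The coordinates of [U] run over a sphere or a hyperboloid: both factors
    satisfy [cos ^+ 2 + sin ^+ 2 = 1] or [cosh ^+ 2 - sinh ^+ 2 = 1]. *)
Lemma tube_coords_norm c t w :
  \sum_(i < 3) frame_sign R (timelike_index c) (lift ord0 i) *
    (tprofile c i t * wprofile c i w) ^+ 2 = tube_sign c.
Proof.
have ch x : cosh x ^+ 2 = 1 + sinh x ^+ 2 by rewrite -(cosh2Bsinh2 x) subrK.
under eq_bigr do rewrite exprMn.
rewrite !big_ord_recl big_ord0 /tprofile /wprofile /frame_sign.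
by case: c => /=; rewrite ?cos2sin2 ?ch; ring.
Qed.

End profiles.

(** * Tubes around Frenet curves *)

Section tube.
Context {R : realType}.
Variables (c : tube_kind) (I : set R) (beta : R -> 'rV[R]_4)
  (F : 'I_4 -> R -> 'rV[R]_4) (k1 k2 k3 : R -> R) (r : R) (D : set 'rV[R]_3).
Hypotheses (frenetF : frenet_curve (timelike_index c) I beta F k1 k2 k3)
  (openD : open D) (D_sub : forall u, D u -> I (u 0 0)).
Implicit Types u v : 'rV[R]_3.

(** The direction [U] as a sum of fields with separated variables; [lift ord0]
    skips the tangent vector [F 0]. *)
Definition direction_field (u : 'rV[R]_3) : 'rV[R]_4 :=
  \sum_(i < 3) split_field (tprofile c i) (wprofile c i) (F (lift ord0 i)) u.

Definition ddirection_field (k : 'I_3) (u : 'rV[R]_3) : 'rV[R]_4 :=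
  \sum_(i < 3) dsplit_field k (tprofile c i) (wprofile c i) (F (lift ord0 i)) u.

Lemma tubeE u : tube c beta F r u =
  split_field (cst 1) (cst 1) beta u + r *: direction_field u.
Proof.
rewrite /tube /tube_direction tube_coordsE /direction_field /split_field.
rewrite mulr1 scale1r !big_ord_recl big_ord0 addr0 addrA.
have i1 : lift ord0 ord0 = 1 :> 'I_3 by exact: val_inj.
have i2 : lift ord0 (lift ord0 ord0) = 2 :> 'I_3 by exact: val_inj.
have j1 : lift ord0 ord0 = 1 :> 'I_4 by exact: val_inj.
have j2 : lift ord0 1 = 2 :> 'I_4 by exact: val_inj.
have j3 : lift ord0 2 = 3 :> 'I_4 by exact: val_inj.
by rewrite i2 i1 j1 j2 j3.
Qed.

Lemma direction_field_norm u : I (u 0 0) ->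
  mink (direction_field u) (direction_field u) = tube_sign c.
Proof.
move=> Iu; rewrite -(tube_coords_norm c (u 0 1) (u 0 2)) mink_suml.
apply: eq_bigr => i _; rewrite mink_sumr (bigD1 i)//= big1 => [|k ki].
  rewrite minkZl minkZr (frenet_norm frenetF)//; ring.
rewrite minkZl minkZr (frenet_orthogonal frenetF) ?mulr0//.
by rewrite (inj_eq lift_inj) eq_sym.
Qed.

Lemma F0_orthogonal_span (y : 'I_3 -> R) s : I s ->
  mink (\sum_(i < 3) y i *: F (lift ord0 i) s) (F 0 s) = 0.
Proof.
move=> Is; rewrite mink_suml big1// => i _.
by rewrite minkZl (frenet_orthogonal frenetF) ?mulr0// eq_sym neq_lift.
Qed.

Let frame_derivable i s : I s ->
  derivable (F i) s 1 /\ derivable (derive1 (F i)) s 1.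
Proof.
have [_ /(_ i) Fs _ _ _ _ _ _ _ _ _ _] := frenetF.
by move=> Is; split; [exact: (Fs 0%N)|exact: (Fs 1%N)].
Qed.

Let curve_derivable s : I s ->
  derivable beta s 1 /\ derivable (derive1 beta) s 1.
Proof.
have [bs _ _ _ _ _ _ _ _ _ _ _] := frenetF.
by move=> Is; split; [exact: (bs 0%N)|exact: (bs 1%N)].
Qed.

Lemma is_derive_direction_field u (k : 'I_3) : I (u 0 0) ->
  is_derive u (delta_mx 0 k) direction_field (ddirection_field k u).
Proof.
move=> Iu.
have -> : direction_field = \sum_(i < 3)
    split_field (tprofile c i) (wprofile c i) (F (lift ord0 i)).
  by apply/funext => v; rewrite fct_sumE.
apply: is_derive_sum => i; apply: is_derive_split_field.
- exact: (twice_derivable_profile _ _).1.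
- exact: (twice_derivable_profile _ _).1.
- exact: (frame_derivable _ _ Iu).1.
Qed.

Lemma continuous_direction_field u : I (u 0 0) ->
  {for u, continuous direction_field}.
Proof.
move=> Iu; apply: (@cvg_big _ _ _ _ _ _ _ (nbhs u)) => [|i _].
  exact: add_continuous.
apply: continuous_split_field.
- exact: (twice_derivable_profile _ _).1.
- exact: (twice_derivable_profile _ _).1.
- exact: (frame_derivable _ _ Iu).1.
Qed.

Lemma derivable_dsplit_field P Q (X : R -> 'rV[R]_4) (u : 'rV[R]_3)
    (k l : 'I_3) :
  twice_derivable P -> twice_derivable Q ->
  derivable X (u 0 0) 1 -> derivable (derive1 X) (u 0 0) 1 ->
  derivable (dsplit_field k P Q X) u (delta_mx 0 l).
Proof.
move=> dP dQ dX ddX.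
apply: ex_derive; apply: is_derive_split_field.
- by case: ifP => _; [exact: (dP _).2|exact: (dP _).1].
- by case: ifP => _; [exact: (dQ _).2|exact: (dQ _).1].
- by case: ifP.
Qed.

Let dtube k u : 'rV[R]_4 :=
  dsplit_field k (cst 1) (cst 1) beta u + r *: ddirection_field k u.

Lemma is_derive_tube u (k : 'I_3) : I (u 0 0) ->
  is_derive u (delta_mx 0 k) (tube c beta F r) (dtube k u).
Proof.
move=> Iu.
have -> : tube c beta F r =
    split_field (cst 1) (cst 1) beta + r \*: direction_field.
  by apply/funext => v; rewrite tubeE.
apply: is_deriveD; last exact: is_deriveZ (is_derive_direction_field _ _ Iu).
apply: is_derive_split_field.
- exact: derivable_cst.
- exact: derivable_cst.
- exact: (curve_derivable _ Iu).1.
Qed.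

(** In the variable [s] the curve itself contributes [beta' = F 0]; in the
    variables [t] and [w] it contributes nothing. *)
Lemma partial_tubeE u (k : 'I_3) : I (u 0 0) ->
  partial k (tube c beta F r) u =
  (k == 0)%:R *: F 0 (u 0 0) + r *: partial k direction_field u.
Proof.
move=> Iu; rewrite /partial.
have [_ ->] := is_derive_tube _ k Iu.
have [_ ->] := is_derive_direction_field _ k Iu.
congr (_ + _); rewrite /dsplit_field /split_field.
have c0 x : derive1 (cst 1 : R -> R) x = 0 by rewrite derive1E derive_cst.
case: k => -[|[|[|//]]] lk /=.
- by rewrite !mulr1 (frenet_tangent frenetF).
- by rewrite c0 mul0r !scale0r.
- by rewrite c0 mulr0 !scale0r.
Qed.

Lemma derivable_partial_tube u (i k : 'I_3) : D u ->
  derivable (partial i (tube c beta F r)) u (delta_mx 0 k).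
Proof.
move=> Du; have Iu := D_sub _ Du.
have dtubeE : \forall v \near u, dtube i v = partial i (tube c beta F r) v.
  apply: filterS (open_nbhs_nbhs (conj openD Du)) => v Dv.
  by have [_ <-] := is_derive_tube _ i (D_sub _ Dv).
apply: (near_eq_derivable dtubeE).
have dcst : twice_derivable (cst 1) := twice_derivable_profile One.
apply: derivableD.
  apply: derivable_dsplit_field => //.
    exact: (curve_derivable _ Iu).1.
  exact: (curve_derivable _ Iu).2.
apply: derivableZ.
have -> : ddirection_field i = \sum_(l < 3)
    dsplit_field i (tprofile c l) (wprofile c l) (F (lift ord0 l)).
  by apply/funext => v; rewrite fct_sumE.
apply: derivable_sum => l.
have [Fd F'd] := frame_derivable (lift ord0 l) _ Iu.
by apply: derivable_dsplit_field => //; exact: twice_derivable_profile.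
Qed.

(** [G_t] and [G_w] only involve derivatives of the coordinates of [U], hence
    stay in the span of [F 1], [F 2], [F 3]. *)
Lemma tangent_orthogonal_partial u (k : 'I_3) : I (u 0 0) -> k != 0 ->
  mink (partial k (tube c beta F r) u) (F 0 (u 0 0)) = 0.
Proof.
move=> Iu k0; rewrite partial_tubeE// (negbTE k0) scale0r add0r minkZl.
rewrite /partial; have [_ ->] := is_derive_direction_field _ k Iu.
rewrite /ddirection_field /dsplit_field (negbTE k0).
by rewrite F0_orthogonal_span ?mulr0.
Qed.

End tube.

Theorem theorem11 (R : realType) (c : tube_kind) (I : set R)
    (beta : R -> 'rV[R]_4) (F : 'I_4 -> R -> 'rV[R]_4) (k1 k2 k3 : R -> R)
    (r : R) (D : set 'rV[R]_3) (N : 'rV[R]_3 -> 'rV[R]_4)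
    (openI : open I) (intervalI : is_interval I)
    (frenetF : frenet_curve (timelike_index c) I beta F k1 k2 k3)
    (r_gt0 : 0 < r)
    (openD : open D)
    (D_sub : forall u, D u -> I (u 0 0))
    (D_regular : forall u, D u -> regular_point (tube c beta F r) u)
    (normalN : unit_normal_field D (tube c beta F r) N) :
  let H := mean_curvature (tube c beta F r) N in
  let K := gauss_curvature (tube c beta F r) N in
  let s : 'I_3 := 0 in let t : 'I_3 := 1 in let w : 'I_3 := 2 in
  forall u, D u ->
    [/\ weingarten_at H K t w u,
        weingarten_at H K s t u &
        weingarten_at H K s w u].
Proof.
move=> H K s t w u Du.
have r0 : r != 0 := lt0r_neq0 r_gt0.
have sign_unit : `|tube_sign c| = 1 :> R.
  by rewrite /tube_sign; case: {+}c; rewrite ?normrN normr1.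
have HK := canal_curvature_affine D (tube c beta F r) N (direction_field c F)
  (fun v => F 0 (v 0 0)) r (tube_sign c) openD r0 sign_unit D_regular normalN.
have affine : {near u, K =1 fun v =>
    3 / r ^+ 2 * H v + 2 * tube_sign c *
      (mink (N u) (direction_field c F u) / tube_sign c) / r ^+ 3}.
  apply: HK => // {Du}u.
  - by move=> /D_sub; exact: continuous_direction_field frenetF _.
  - move=> k /D_sub Iu; apply: ex_derive.
    exact: is_derive_direction_field frenetF _ _ Iu.
  - by move=> i k; exact: derivable_partial_tube frenetF openD D_sub _ _ _.
  - by move=> /D_sub; exact: direction_field_norm frenetF _.
  - move=> /D_sub Iu; rewrite minkC.
    exact: F0_orthogonal_span frenetF _ _ Iu.
  - by move=> k /D_sub; exact: partial_tubeE frenetF _ _.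
  - by move=> k /D_sub; exact: tangent_orthogonal_partial frenetF _ _.
have a0 : 3 / r ^+ 2 != 0 by rewrite mulf_neq0 ?invr_eq0 ?expf_neq0// pnatr_eq0.
by split; exact: weingarten_of_affine a0 affine.
Qed.
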